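(* Let $t\in\mathbb R\setminus\{0\}$ and let $f(q_t)=\sum_{k=0}^\infty q_t^kf_k$ be a power series with coefficients $f_k\in\mathbb H_t^{n\times m}$, converging in a neighborhood of the origin. Then $f$ is rational if and only if it is the quotient of a matrix polynomial and of a real scalar polynomial, i.e. if and only if there exist a polynomial $P(q_t)=\sum_{k}q_t^kP_k$ with $P_k\in\mathbb H_t^{n\times m}$ and a polynomial $p(q_t)=\sum_kq_t^kp_k$ with $p_k\in\mathbb R$ and $p(0)\neq0$ such that $f=P\star p^{-\star}$.
   Context: For $t\in\mathbb R\setminus\{0\}$, $\mathbb H_t$ is the real algebra (matrix addition and multiplication) of matrices $q_t=\begin{pmatrix}a&tb\\ \overline b&\overline a\end{pmatrix}$, $a,b\in\mathbb C$; $\mathbb H_t^{n\times m}$ denotes $n\times m$ matrices with entries in $\mathbb H_t$. The variable $q_t\in\mathbb H_t$ multiplies a matrix entrywise from the left. For power series with matrix coefficients of compatible sizes, the $\star$-product is $\left(\sum q_t^n\alpha_n\right)\star\left(\sum q_t^n\beta_n\right)=\sum_nq_t^n\sum_{k=0}^n\alpha_{n-k}\beta_k$, and $S^{-\star}$ is the inverse with respect to $\star$; real scalar series $\star$-commute with all others. A power series $f(q_t)=\sum_{k=0}^\infty q_t^kf_k$ with $f_k\in\mathbb H_t^{n\times m}$, converging in a neighborhood of the origin, is called rational if there exist $N\in\mathbb N_0$ and matrices $(A,B,C)\in\mathbb H_t^{N\times N}\times\mathbb H_t^{N\times m}\times\mathbb H_t^{n\times N}$ such that, with $D=f(0)$,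 $f(q_t)=D+q_t\star C\star(I_N-q_t\star A)^{-\star}\star B$ (equivalently, $f_k=CA^{k-1}B$ for $k\ge1$). *)

(* Defs.v *)
From HB Require Import structures.
From mathcomp Require Import all_boot all_order all_algebra.
From mathcomp Require Import all_classical all_reals all_analysis.
From mathcomp Require Import complex ring.
Set Implicit Arguments.
Unset Strict Implicit.
Unset Printing Implicit Defensive.
Import Order.TTheory GRing.Theory Num.Theory.
Import numFieldNormedType.Exports.
Local Open Scope classical_set_scope.
Local Open Scope ring_scope.

(* The complex numbers, packed as a numClosedFieldType so that the generic
   norm and topology of MathComp-Analysis apply to them. *)
Definition Cx (R : realType) : numClosedFieldType := R[i].

Definition ofR (R : realType) (x : R) : Cx R := x%:C%C.

Lemma conj_ofR (R : realType) (x : R) : (ofR x)^* = ofR x.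
Proof. exact: conjc_real. Qed.

Definition Ht_mx (R : realType) (t : R) (a b : Cx R) : 'M[Cx R]_2 :=
  \matrix_(i < 2, j < 2)
    if i == ord0 then (if j == ord0 then a else ofR t * b)
    else (if j == ord0 then b^* else a^*).

Definition Ht_pred (R : realType) (t : R) : {pred 'M[Cx R]_2} :=
  fun M => M == Ht_mx t (M ord0 ord0) (M ord_max ord0)^*.

Lemma Ht_predP (R : realType) (t : R) (M : 'M[Cx R]_2) :
  reflect (exists a b : Cx R, M = Ht_mx t a b) (M \in Ht_pred t).
Proof.
apply: (iffP eqP) => [-> | [a [b ->]]]; first by do 2 eexists.
by apply/matrixP => i j; rewrite !mxE /= conjCK.
Qed.

Lemma Ht_mx_subproof (R : realType) (t : R) (a b : Cx R) :
  Ht_mx t a b \in Ht_pred t.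
Proof. by apply/Ht_predP; exists a, b. Qed.

Lemma Ht_subring_closed (R : realType) (t : R) : subring_closed (Ht_pred t).
Proof.
split.
- apply/Ht_predP; exists 1, 0; apply/matrixP => i j; rewrite !mxE.
  by case: i j => [[|[]]] // ? [[|[]]] // ? /=; rewrite ?mulr0 ?rmorph0 ?rmorph1.
- move=> _ _ /Ht_predP[a [b ->]] /Ht_predP[c [d ->]].
  apply/Ht_predP; exists (a - c), (b - d); apply/matrixP => i j; rewrite !mxE.
  by case: i j => [[|[]]] // ? [[|[]]] // ? /=; rewrite ?mulrBr ?rmorphB.
- move=> _ _ /Ht_predP[a [b ->]] /Ht_predP[c [d ->]].
  apply/Ht_predP; exists (a * c + ofR t * b * d^*), (a * d + b * c^*).
  apply/matrixP => i j; rewrite !mxE !big_ord_recl big_ord0 !mxE /= addr0.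
  by case: i j => [[|[]]] // ? [[|[]]] // ? /=;
    rewrite ?rmorphD ?rmorphM /= ?conj_ofR ?conjCK //; ring.
Qed.

HB.instance Definition _ (R : realType) (t : R) :=
  GRing.isSubringClosed.Build 'M[Cx R]_2 (Ht_pred t) (Ht_subring_closed t).

Record Ht (R : realType) (t : R) := MkHt {
  Ht_val :> 'M[Cx R]_2;
  Ht_valP : Ht_val \in Ht_pred t }.

HB.instance Definition _ (R : realType) (t : R) := [isSub for @Ht_val R t].
HB.instance Definition _ (R : realType) (t : R) := [Choice of Ht t by <:].
HB.instance Definition _ (R : realType) (t : R) :=
  [SubChoice_isSubNzRing of Ht t by <:].
(* H_t carries the topology induced by 'M[Cx R]_2. *)
HB.instance Definition _ (R : realType) (t : R) :=
  Topological.copy (Ht t) (initial_topology (@Ht_val R t)).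

Definition Ht_of_real (R : realType) (t : R) (x : R) : Ht t :=
  MkHt (Ht_mx_subproof t (ofR x) 0).

(* A power series sum_k q^k f_k is given by its coefficient sequence f. *)
Definition mxseries (R : realType) (t : R) (n m : nat) : Type :=
  nat -> 'M[Ht t]_(n, m).

Definition cvg_near_origin (R : realType) (t : R) (n m : nat)
    (f : mxseries t n m) : Prop :=
  \forall q \near (0 : Ht t), exists S : 'M[Ht t]_(n, m),
    (fun K : nat => \sum_(k < K) q ^+ k *: f k) @ \oo --> S.

Definition star (R : realType) (t : R) (n m p : nat)
    (f : mxseries t n m) (g : mxseries t m p) : mxseries t n p :=
  fun k => \sum_(i < k.+1) f (k - i)%N *m g i.

Definition cst_series (R : realType) (t : R) (n m : nat)
    (M : 'M[Ht t]_(n, m)) : mxseries t n m :=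
  fun k => if k == 0%N then M else 0.

(* A real scalar polynomial p, acting as the scalar matrix series p * I_n. *)
Definition scalar_series (R : realType) (t : R) (n : nat) (p : {poly R}) :
    mxseries t n n :=
  fun k => (Ht_of_real t p`_k)%:M.

Definition is_star_inverse (R : realType) (t : R) (n : nat)
    (S T : mxseries t n n) : Prop :=
  star S T =1 cst_series 1%:M /\ star T S =1 cst_series 1%:M.

(* The variable q_t is scalar_series _ _ 'X, and f(0) is f 0. *)
Definition rational_series (R : realType) (t : R) (n m : nat)
    (f : mxseries t n m) : Prop :=
  cvg_near_origin f /\
  exists (N : nat) (A : 'M[Ht t]_N) (B : 'M[Ht t]_(N, m))
         (C : 'M[Ht t]_(n, N)) (T : mxseries t N N),
    is_star_inverse
      (cst_series 1%:M \- star (scalar_series t N 'X) (cst_series A)) T /\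
    f =1 cst_series (f 0%N) \+
         star (star (star (scalar_series t n 'X) (cst_series C)) T)
              (cst_series B).

Definition polynomial_series (R : realType) (t : R) (n m : nat)
    (P : mxseries t n m) : Prop :=
  exists d : nat, forall k : nat, (d <= k)%N -> P k = 0.

(* Main.v *)
(* If f_(k+1) = C A^k B, the powers of A lie in a finite-dimensional real vector
   space, so c(A) = 0 for some nonzero real polynomial c; the reversed
   polynomial p of c has p(0) != 0 and kills the tail of f * p, because real
   scalars are central.  Conversely, f * p = P is a linear recurrence with
   constant real coefficients for the tail of f, which a block companion matrix
   realizes. *)
From HB Require Import structures.
Require Import Defs.
From mathcomp Require Import all_boot all_order all_algebra.
From mathcomp Require Import all_classical all_reals all_analysis.
From mathcomp Require Import complex zify.
Set Implicit Arguments.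
Unset Strict Implicit.
Unset Printing Implicit Defensive.
Import GRing.Theory.
Local Open Scope ring_scope.

(** * Real scalars as central elements of [Ht t] *)

Section RealScalars.
Variables (R : realType) (t : R).
Implicit Types (x y : R) (z : Ht t).

Lemma Ht_val_inj : injective (@Ht_val R t). Proof. exact: val_inj. Qed.

Lemma Ht_val0 : Ht_val (0 : Ht t) = 0. Proof. exact: (rmorph0 \val). Qed.

Lemma Ht_val1 : Ht_val (1 : Ht t) = 1. Proof. exact: (rmorph1 \val). Qed.

Lemma Ht_valB z z' : Ht_val (z - z') = Ht_val z - Ht_val z'.
Proof. exact: (rmorphB \val). Qed.

Lemma Ht_valM z z' : Ht_val (z * z') = Ht_val z *m Ht_val z'.
Proof. exact: (rmorphM \val). Qed.

Lemma Ht_val_of_real x : Ht_val (Ht_of_real t x) = (ofR x)%:M.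
Proof.
apply/matrixP => i j; rewrite !mxE mulr0 conj_ofR.
by case: i j => [[|[]]] // ? [[|[]]] // ?; rewrite /= ?rmorph0.
Qed.

Lemma Ht_of_real_is_additive : zmod_morphism (Ht_of_real t).
Proof.
move=> x y; apply: Ht_val_inj.
by rewrite Ht_valB !Ht_val_of_real /ofR !rmorphB.
Qed.

Lemma Ht_of_real_is_monoid_morphism : monoid_morphism (Ht_of_real t).
Proof.
split=> [|x y]; apply: Ht_val_inj.
  by rewrite Ht_val1 Ht_val_of_real /ofR !rmorph1.
by rewrite Ht_valM !Ht_val_of_real /ofR rmorphM scalar_mxM.
Qed.

HB.instance Definition _ :=
  GRing.isZmodMorphism.Build R (Ht t) (Ht_of_real t) Ht_of_real_is_additive.
HB.instance Definition _ :=
  GRing.isMonoidMorphism.Build R (Ht t) (Ht_of_real t)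
    Ht_of_real_is_monoid_morphism.

Lemma Ht_of_realC x z : z * Ht_of_real t x = Ht_of_real t x * z.
Proof.
apply: Ht_val_inj; rewrite !Ht_valM !Ht_val_of_real.
exact: scalar_mxC.
Qed.

Lemma mulmx_Ht_of_real (n m : nat) (M : 'M[Ht t]_(n, m)) x :
  M *m (Ht_of_real t x)%:M = Ht_of_real t x *: M.
Proof.
apply/matrixP => i j; rewrite !mxE (bigD1 j) //= big1 => [|k /negbTE kj].
  by rewrite !mxE eqxx mulr1n addr0 Ht_of_realC.
by rewrite !mxE kj mulr0n mulr0.
Qed.

Lemma mulmx_Ht_of_realZ (n m p : nat) (M : 'M[Ht t]_(n, m))
    (M' : 'M[Ht t]_(m, p)) x :
  M *m (Ht_of_real t x *: M') = Ht_of_real t x *: (M *m M').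
Proof. by rewrite -mul_scalar_mx mulmxA mulmx_Ht_of_real scalemxAl. Qed.

End RealScalars.

(** * Star-product algebra and the coefficient form of rationality *)

Section Star.
Variables (R : realType) (t : R).

Lemma eq_star (n m p : nat) (f f' : mxseries t n m) (g g' : mxseries t m p) :
  f =1 f' -> g =1 g' -> star f g =1 star f' g'.
Proof. by move=> ff gg k; apply: eq_bigr => i _; rewrite ff gg. Qed.

Lemma star_rev (n m p : nat) (f : mxseries t n m) (g : mxseries t m p) k :
  star f g k = \sum_(i < k.+1) f i *m g (k - i)%N.
Proof.
rewrite /star (reindex_inj rev_ord_inj) /=.
by apply: eq_bigr => i _; rewrite subSS subKn // -ltnS.
Qed.

Lemma starA (n m p q : nat) (f : mxseries t n m) (g : mxseries t m p)
    (h : mxseries t p q) : star f (star g h) =1 star (star f g) h.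
Proof.
move=> i; rewrite star_rev [RHS]/star.
(* Both bracketings sum [F] over the triangle j + k <= i, once by rows and once by columns. *)
pose F j k := f j *m (g (i - j - k)%N *m h k).
transitivity (\sum_(j < i.+1) \sum_(k < i.+1 | (k <= i - j)%N) F j k).
  apply: eq_bigr => j _; rewrite /star mulmx_sumr.
  by rewrite (big_ord_narrow_leq (leq_subr _ _)).
rewrite (exchange_big_dep predT) //=; apply: eq_bigr => k _.
transitivity (\sum_(j < i.+1 | (j <= i - k)%N) F j k).
  by apply: eq_bigl => j; have := ltn_ord j; have := ltn_ord k; lia.
rewrite (big_ord_narrow_leq (leq_subr _ _)) star_rev mulmx_suml.
by apply: eq_bigr => j _; rewrite /F -!subnDA addnC mulmxA.
Qed.

Lemma star_cst (n m p : nat) (f : mxseries t n m) (M : 'M[Ht t]_(m, p)) k :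
  star f (cst_series M) k = f k *m M.
Proof.
rewrite /star big_ord_recl subn0 big1 ?addr0 // => i _.
by rewrite /cst_series /= mulmx0.
Qed.

Lemma cst_star (n m p : nat) (M : 'M[Ht t]_(n, m)) (f : mxseries t m p) k :
  star (cst_series M) f k = M *m f k.
Proof.
rewrite star_rev big_ord_recl subn0 big1 ?addr0 // => i _.
by rewrite /cst_series /= mul0mx.
Qed.

Lemma star_scalar_series (n m : nat) (f : mxseries t n m) (p : {poly R}) k :
  star f (scalar_series t m p) k
    = \sum_(i < k.+1) Ht_of_real t p`_i *: f (k - i)%N.
Proof. by apply: eq_bigr => i _; rewrite mulmx_Ht_of_real. Qed.

Lemma star_X (n m : nat) (f : mxseries t n m) k :
  star (scalar_series t n 'X) f k = if k is k'.+1 then f k' else 0.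
Proof.
rewrite star_rev /scalar_series; case: k => [|k].
  by rewrite big_ord1 coefX rmorph0 raddf0 mul0mx.
rewrite 2!big_ord_recl big1 => [|i _]; last by rewrite coefX rmorph0 raddf0 mul0mx.
by rewrite !coefX rmorph0 raddf0 mul0mx add0r addr0 rmorph1 mul1mx subSS subn0.
Qed.

Lemma star_scalarC (n m : nat) (f : mxseries t n m) (p : {poly R}) :
  star (scalar_series t n p) f =1 star f (scalar_series t m p).
Proof.
move=> k; rewrite star_scalar_series star_rev.
by apply: eq_bigr => i _; rewrite mul_scalar_mx.
Qed.

Lemma star_subl (n m p : nat) (f g : mxseries t n m) (h : mxseries t m p) k :
  star (f \- g) h k = star f h k - star g h k.
Proof. by rewrite /star -sumrB; apply: eq_bigr => i _; rewrite mulmxBl. Qed.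

Lemma star_subr (n m p : nat) (f : mxseries t n m) (g h : mxseries t m p) k :
  star f (g \- h) k = star f g k - star f h k.
Proof. by rewrite /star -sumrB; apply: eq_bigr => i _; rewrite mulmxBr. Qed.

(** Comparing coefficients in S * T = 1 gives T_0 = 1 and T_(k+1) = A T_k, which forces the
    geometric series. The identity T * S = 1 then holds because A commutes with its powers. *)
Lemma resolventP (N : nat) (A : 'M[Ht t]_N) (T : mxseries t N N) :
  is_star_inverse
    (cst_series 1%:M \- star (scalar_series t N 'X) (cst_series A)) T
  <-> T =1 (fun k => A ^+ k).
Proof.
set S := cst_series _ \- _.
have ST k : star S T k = T k - (if k is k'.+1 then A *m T k' else 0).
  rewrite star_subl cst_star mul1mx -starA star_X.
  by case: k => // k; rewrite cst_star.
have TS k : star T S k = T k - (if k is k'.+1 then T k' *m A else 0).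
  rewrite star_subr star_cst mulmx1 starA star_cst -star_scalarC star_X.
  by case: k => [|k]; rewrite ?mul0mx.
split=> [[eST _] k | eT].
  elim: k => [|k IHk]; first by rewrite -[LHS]subr0 -(ST 0%N) eST expr0.
  by have := eST k.+1; rewrite ST => /subr0_eq ->; rewrite IHk exprS.
split=> -[|k]; rewrite ?ST ?TS !eT ?subr0 ?expr0 //.
  by rewrite exprS subrr.
by rewrite exprSr subrr.
Qed.

(** Removes the star-inverse: by [resolventP] it consists of the powers of A, and the leading factor
    q shifts the index by one. The constant term f(0) stays free, being absorbed in D. *)
Lemma rational_coefP (n m : nat) (f : mxseries t n m) :
  rational_series f <-> cvg_near_origin f /\
  exists (N : nat) (A : 'M[Ht t]_N) (B : 'M[Ht t]_(N, m))
         (C : 'M[Ht t]_(n, N)), forall k, f k.+1 = C *m A ^+ k *m B.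
Proof.
have realE N (B : 'M[Ht t]_(N, m)) (C : 'M[Ht t]_(n, N)) T k :
    (cst_series (f 0%N) \+
       star (star (star (scalar_series t n 'X) (cst_series C)) T)
         (cst_series B)) k = if k is k'.+1 then C *m T k' *m B else f 0%N.
  rewrite /= star_cst -starA star_X.
  by case: k => [|k]; rewrite ?mul0mx ?addr0 // cst_star /cst_series add0r.
split=> -[hf [N [A [B [C]]]]] => [[T [/resolventP eT ef]]|ef]; split=> //.
  by exists N, A, B, C => k; rewrite ef realE eT.
exists N, A, B, C, (fun k => A ^+ k).
split=> [|k]; first exact/resolventP.
by rewrite realE; case: k.
Qed.

End Star.

(** * Star-inverses of real polynomials with nonzero constant term *)

Lemma coef_exp_lt (R : nzRingType) (q : {poly R}) j k :
  q`_0 = 0 -> (k < j)%N -> (q ^+ j)`_k = 0.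
Proof.
move=> q0; elim: j k => // j IHj k ltkj.
rewrite exprS coefM big_ord_recl q0 mul0r add0r big1 // => i _.
by rewrite IHj ?mulr0 //= /bump; have := ltn_ord i; lia.
Qed.

(* Writing [p = p(0) (1 - q)] with [q(0) = 0], the inverse is the geometric
   series of [q] divided by [p(0)]. *)
Lemma inverse_series (R : fieldType) (p : {poly R}) : p`_0 != 0 ->
  exists u : nat -> R,
    forall k, \sum_(i < k.+1) p`_i * u (k - i)%N = (k == 0%N)%:R.
Proof.
move=> p0; pose q := 1 - (p`_0)^-1 *: p.
have q0 : q`_0 = 0 by rewrite coefB coef1 coefZ mulVf // subrr.
pose G j := \sum_(i < j) q ^+ i.
(* Powers beyond the k-th do not reach degree k, so the k-th coefficient of the partial sums is
   stable from [k.+1] terms on. *)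
have GE j k : (k < j)%N -> (G j)`_k = (G k.+1)`_k.
  elim: j => // j IHj; rewrite ltnS leq_eqVlt => /predU1P[-> //|ltkj].
  by rewrite /G big_ord_recr coefD coef_exp_lt // addr0 IHj.
exists (fun k => (p`_0)^-1 * (G k.+1)`_k) => k.
(* The product telescopes to 1 - q^(k+1), which agrees with 1 up to degree k. *)
have -> : (k == 0%N)%:R = ((1 - q) * G k.+1)`_k.
  rewrite -[1 - q]opprB mulNr -subrX1 opprB coefB coef1.
  by rewrite coef_exp_lt ?subr0.
rewrite subKr coefM; apply: eq_bigr => i _.
rewrite coefZ (GE k.+1 (k - i)%N) ?ltnS ?leq_subr //.
by rewrite mulrCA mulrA.
Qed.

Lemma scalar_series_inverse (R : realType) (t : R) (m : nat) (p : {poly R}) :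
  p.[0] != 0 -> exists T, is_star_inverse (scalar_series t m p) T.
Proof.
rewrite horner_coef0 => /inverse_series[u pu].
exists (fun k => (Ht_of_real t (u k))%:M).
set T := fun k => _.
have pT : star (scalar_series t m p) T =1 cst_series 1%:M.
  move=> k; rewrite star_rev.
  transitivity ((Ht_of_real t (\sum_(i < k.+1) p`_i * u (k - i)%N))%:M
                : 'M[Ht t]_m).
    rewrite rmorph_sum raddf_sum.
    by apply: eq_bigr => i _; rewrite -scalar_mxM -rmorphM.
  by rewrite pu /cst_series; case: eqP; rewrite ?rmorph1 // rmorph0 raddf0.
by split=> // k; rewrite -star_scalarC pT.
Qed.

(** * Real linear dependence of matrices over [Ht t] *)

Section Dependence.
Variables (R : realType) (t : R).
Implicit Types (x : R) (z : Ht t).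

(** All eight real and imaginary parts of the entries are taken, although [Ht t] has real dimension
    four: the dimension count only uses finitely many real-linear maps that jointly separate
    points. *)
Definition Ht_coord (y : 'I_2 * 'I_2 * bool) z : R :=
  let: (i, j, b) := y in
  if b then Re (Ht_val z i j) else Im (Ht_val z i j).

Lemma Ht_coord_is_additive y : zmod_morphism (Ht_coord y).
Proof.
case: y => [[i j] b] z z'; rewrite /Ht_coord Ht_valB !mxE.
by case: b; case: (Ht_val z i j) => ? ?; case: (Ht_val z' i j) => ? ?.
Qed.

HB.instance Definition _ y :=
  GRing.isZmodMorphism.Build (Ht t) R (Ht_coord y) (Ht_coord_is_additive y).

Lemma Ht_coordZ x z y : Ht_coord y (Ht_of_real t x * z) = x * Ht_coord y z.
Proof.
case: y => [[i j] b]; rewrite /Ht_coord Ht_valM Ht_val_of_real.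
rewrite mul_scalar_mx !mxE.
by case: b; case: (Ht_val z i j) => u v /=; rewrite mul0r ?subr0 ?addr0.
Qed.

Lemma Ht_coord_eq0 z : (forall y, Ht_coord y z = 0) -> z = 0.
Proof.
move=> z0; apply: Ht_val_inj; rewrite Ht_val0; apply/matrixP => i j; rewrite mxE.
have := z0 (i, j, true); have := z0 (i, j, false); rewrite /Ht_coord.
by case: (Ht_val z i j) => u v /= -> ->.
Qed.

(** The first K + 1 matrices have K real coordinates each, so the coordinate matrix [V] has a
    nonzero left kernel vector, read as [c]. Applied to the powers of a matrix, this stands in for
    Cayley-Hamilton over the noncommutative [Ht t]. *)
Lemma real_dependence (n m : nat) (M : mxseries t n m) :
  exists2 c : {poly R}, c != 0 &
    \sum_(i < size c) Ht_of_real t c`_i *: M i = 0.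
Proof.
pose K := #|{: 'I_n * 'I_m * ('I_2 * 'I_2 * bool)}|.
pose V : 'M[R]_(K.+1, K) :=
  \matrix_(k, x) Ht_coord (enum_val x).2 (M k (enum_val x).1.1 (enum_val x).1.2).
have: kermx V != 0.
  by rewrite kermx_eq0 -row_leq_rank -ltnNge ltnS rank_leq_col.
case/rowV0Pn => v /sub_kermxP vV0 v0.
exists (rVpoly v).
  by apply: contraNneq v0 => rv0; rewrite -[v]rVpolyK rv0 raddf0.
have szv : (size (rVpoly v) <= K.+1)%N by exact: size_poly.
(* [rVpoly v] may have size below K + 1; the sum is padded to match the kernel relation. *)
rewrite (big_ord_widen _ (fun i => Ht_of_real t (rVpoly v)`_i *: M i) szv).
rewrite big_mkcond /=; apply/matrixP => i j; rewrite mxE; apply: Ht_coord_eq0 => y.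
rewrite summxE raddf_sum.
have /matrixP/(_ 0 (enum_rank (i, j, y))) := vV0; rewrite !mxE.
under eq_bigr do rewrite mxE enum_rankK -coef_rVpoly_ord /=.
move=> vV; rewrite -[RHS]vV.
apply: eq_bigr => k _.
case: ltnP => [_|szk]; first by rewrite mxE [LHS]Ht_coordZ.
by rewrite mxE raddf0 nth_default ?mul0r.
Qed.

End Dependence.

(** The state [st k] stacks the window f_(k+1), ..., f_(k+D+1). [A] advances the window by one, [C]
    reads its first block, and the initial window serves as B. *)
Lemma recurrence_realization (R : realType) (t : R) (n m D : nat)
    (f : mxseries t n m) (a : nat -> R) :
  (forall k, f (k + D.+1).+1 =
     \sum_(i < D.+1) Ht_of_real t (a i) *: f (k + i).+1) ->
  exists (N : nat) (A : 'M[Ht t]_N) (B : 'M[Ht t]_(N, m))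
         (C : 'M[Ht t]_(n, N)), forall k, f k.+1 = C *m A ^+ k *m B.
Proof.
move=> rec; pose I : finType := ('I_D.+1 * 'I_n)%type; pose N := #|I|.
pose ev : 'I_N -> I := enum_val.
(* Scalar companion matrix: shift rows, then the recurrence in the last row. [A] below is its
   Kronecker product with the identity of size n. *)
pose al (i j : 'I_D.+1) := if i == D :> nat then a j else (j == i.+1 :> nat)%:R.
have alE k (i : 'I_D.+1) :
    \sum_j Ht_of_real t (al i j) *: f (k + j).+1 = f (k + i.+1).+1.
  rewrite /al; have [-> | neiD] := eqVneq (i : nat) D; first by rewrite rec.
  have ltiD : (i.+1 < D.+1)%N by have := ltn_ord i; lia.
  rewrite (bigD1 (Ordinal ltiD)) //= eqxx rmorph1 scale1r big1 ?addr0 // => j.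
  by rewrite -val_eqE /= => /negbTE ->; rewrite rmorph0 scale0r.
pose st k : 'M[Ht t]_(N, m) :=
  \matrix_(x, j) f (k + (ev x).1).+1 (ev x).2 j.
pose A : 'M[Ht t]_N := \matrix_(x, y)
  if (ev x).2 == (ev y).2
  then Ht_of_real t (al (ev x).1 (ev y).1) else 0.
pose C : 'M[Ht t]_(n, N) := \matrix_(i, x) (ev x == (ord0, i))%:R.
have sumI (F : I -> Ht t) : \sum_(x < N) F (ev x) = \sum_i \sum_j F (i, j).
  rewrite pair_big /ev -(big_enum_val F) /=.
  by apply: eq_big => -[].
have Ast k : A *m st k = st k.+1.
  apply/matrixP => x j; rewrite !mxE.
  under eq_bigr do rewrite !mxE.
  rewrite (sumI (fun y => (if (ev x).2 == y.2
    then Ht_of_real t (al (ev x).1 y.1) else 0) * f (k + y.1).+1 y.2 j)) /=.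
  rewrite addSnnS -alE summxE; apply: eq_bigr => i _.
  rewrite (bigD1 (ev x).2) //= eqxx big1 ?addr0 ?mxE // => l.
  by rewrite eq_sym => /negbTE ->; rewrite mul0r.
have Akst k : A ^+ k *m st 0%N = st k.
  elim: k => [|k IHk]; first by rewrite expr0 mul1mx.
  by rewrite exprS -mulmxE -mulmxA IHk Ast.
exists N, A, (st 0%N), C => k; rewrite -mulmxA Akst.
apply/matrixP => i j; rewrite !mxE (bigD1 (enum_rank (ord0, i))) //= big1.
  by rewrite !mxE /ev enum_rankK eqxx mul1r addr0 addn0.
move=> x; rewrite -(inj_eq enum_val_inj) enum_rankK mxE => /negbTE xi.
by rewrite /ev xi mul0r.
Qed.

Theorem theorem7p7 (R : realType) (t : R) (ht : t != 0) (n m : nat)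
    (f : mxseries t n m) (hf : cvg_near_origin f) :
  rational_series f <->
  exists (P : mxseries t n m) (p : {poly R}) (T : mxseries t m m),
    [/\ polynomial_series P, p.[0] != 0,
        is_star_inverse (scalar_series t m p) T & f =1 star P T].
Proof.
split=> [/rational_coefP[_ [N [A [B [C fE]]]]] | [P [p [T [[d P0] p0 [pT Tp] fE]]]]].
  have [c c0 cA] := real_dependence (fun k => A ^+ k : 'M[Ht t]_N).
  pose d := (size c).-1.
  have szc : size c = d.+1 by rewrite /d prednK // lt0n size_poly_eq0.
  (* Reversing [c] turns its leading coefficient into p(0). *)
  pose p := \poly_(i < d.+1) c`_(d - i).
  have p0 : p.[0] != 0.
    by rewrite horner_coef0 coef_poly subn0 -/(lead_coef c) lead_coef_eq0.
  have [T [pT Tp]] := scalar_series_inverse t m p0.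
  exists (star f (scalar_series t m p)), p, T; split=> // [|k]; last first.
    by rewrite -starA (eq_star (fun=> erefl) pT) star_cst mulmx1.
  (* For k > d every index k - i with i <= d is positive, so [fE] covers all terms and f(0) never
     enters. *)
  exists d.+1 => k ltdk; rewrite star_scalar_series.
  pose F i := Ht_of_real t p`_i *: f (k - i)%N.
  have szk : (d.+1 <= k.+1)%N by lia.
  transitivity (\sum_(i < d.+1) F i).
    rewrite (big_ord_widen _ F szk) [RHS]big_mkcond /=; apply: eq_bigr => i _.
    case: ltnP => // ledi; rewrite /F nth_default ?rmorph0 ?scale0r //.
    exact: leq_trans (size_poly _ _) ledi.
  rewrite (reindex_inj rev_ord_inj) /=.
  (* After the reversal, centrality of real scalars lets c(A) be factored out between powers of A
     and B. *)
  transitivity (C *m A ^+ (k - d.+1) *m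
    (\sum_(i < size c) Ht_of_real t c`_i *: A ^+ i) *m B); last first.
    by rewrite cA mulmx0 mul0mx.
  rewrite szc mulmx_sumr mulmx_suml; apply: eq_bigr => i _.
  have ltid := ltn_ord i.
  rewrite /F subSS coef_poly ltnS leq_subr subKn //.
  have -> : (k - (d - i))%N = (k - d.+1 + i).+1 by lia.
  rewrite fE mulmx_Ht_of_realZ -scalemxAl exprD; congr (_ *: _).
  by rewrite -mulmxE !mulmxA.
apply/rational_coefP; split=> //.
have fp : star f (scalar_series t m p) =1 P.
  move=> k; rewrite (eq_star fE (fun=> erefl)) -starA.
  by rewrite (eq_star (fun=> erefl) Tp) star_cst mulmx1.
rewrite horner_coef0 in p0.
(* Large enough that P vanishes at every index k + D + 2 and p has no coefficient beyond D. The
   recurrence is f * p = P at that index, solved for f_(k+D+2) by dividing by p(0). *)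
pose D := (size p + d)%N.
apply: (@recurrence_realization _ _ _ _ D f
  (fun i => - (p`_0)^-1 * p`_(D.+1 - i))) => k.
have := fp (k + D.+1).+1; rewrite P0; last by rewrite /D; lia.
rewrite star_scalar_series.
pose F i := Ht_of_real t p`_i *: f ((k + D.+1).+1 - i)%N.
have -> : \sum_(i < (k + D.+1).+2) F i = \sum_(i < D.+2) F i.
  have szD : (D.+2 <= (k + D.+1).+2)%N by lia.
  rewrite (big_ord_widen _ F szD) [RHS]big_mkcond /=; apply: eq_bigr => i _.
  case: ltnP => // leDi; rewrite /F nth_default ?rmorph0 ?scale0r //.
  by apply: leq_trans (ltnW (ltnW leDi)); exact: leq_addr.
rewrite big_ord_recl (reindex_inj rev_ord_inj) /F /= subn0.
move/(canRL (addrK _)); rewrite sub0r => /(congr1 ( *:%R (Ht_of_real t (p`_0)^-1))).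
rewrite scalerA -rmorphM mulVf // rmorph1 scale1r => ->.
rewrite scalerN scaler_sumr -sumrN; apply: eq_bigr => i _.
have ltiD := ltn_ord i.
rewrite scalerA -rmorphM mulNr rmorphN scaleNr /bump /= add1n.
congr (- (Ht_of_real t (_ * p`_ _) *: f _)); lia.
Qed.
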